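(* Let $1\le p<\infty$. The intrinsic $L_p$ metric $\delta_p^*$ is intrinsic, i.e. it does not depend on the dimension of the ambient space in which it is computed. Precisely: let $d>m\ge 1$ be integers, let $K,L\subset\mathbb{R}^d$ be convex bodies both contained in an $m$-dimensional linear subspace $S\subset\mathbb{R}^d$, and let $\sigma:\mathbb{R}^d\to\mathbb{R}^m$ be the composition of the orthogonal projection of $\mathbb{R}^d$ onto $S$ with a linear isometry $S\to\mathbb{R}^m$. Then $$\delta_p^*(K,L)=\delta_p^*(\sigma K,\sigma L),$$ where the left-hand side is computed in $\mathbb{R}^d$ and the right-hand side is computed in $\mathbb{R}^m$.
   Context: A convex body in $\mathbb{R}^d$ is a nonempty compact convex subset of $\mathbb{R}^d$ (it need not have interior points). Its support function is $h_K(x)=\max_{y\in K}\langle x,y\rangle$ for $x\in\mathbb{R}^d$. Let $Z^{(d)}=(Z_1,\ldots,Z_d)$ be a vector of independent standard Gaussian random variables. For $1\le p<\infty$ and convex bodies $K,L\subset\mathbb{R}^d$, the intrinsic $L_p$ metric (computed in $\mathbb{R}^d$) is $$\delta_p^*(K,L)=\left[c_p\,E\left|h_K(Z^{(d)})-h_L(Z^{(d)})\right|^p\right]^{1/p},\qquad c_p=\frac{1}{E|Z_1|^p}=\frac{\pi^{1/2}}{2^{p/2}\,\Gamma\left((p+1)/2\right)}.$$ *)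

(* Defs.v *)
From HB Require Import structures.
From mathcomp Require Import all_boot all_order all_algebra.
From mathcomp Require Import all_classical all_reals all_analysis.
Import Order.TTheory GRing.Theory Num.Theory.
Import numFieldNormedType.Exports.

Set Implicit Arguments.
Unset Strict Implicit.
Unset Printing Implicit Defensive.

Local Open Scope classical_set_scope.
Local Open Scope ring_scope.

Section Euclidean.
Context {R : realType}.

Definition dot {n : nat} (x y : 'rV[R]_n) : R := \sum_(i < n) x 0 i * y 0 i.

(* The norm `|x| carried by 'rV[R]_n is the sup norm, so the Euclidean norm is
   defined separately; both induce the same topology. *)
Definition enorm {n : nat} (x : 'rV[R]_n) : R := Num.sqrt (dot x x).

Definition orthogonal_projection {n : nat} (S : {vspace 'rV[R]_n})
    (proj : 'rV[R]_n -> subvs_of S) : Prop :=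
  forall x y, y \in S -> dot (x - vsval (proj x)) y = 0.

Definition euclidean_isometry {n m : nat} (S : {vspace 'rV[R]_n})
    (iota : subvs_of S -> 'rV[R]_m) : Prop :=
  forall u v, enorm (iota u - iota v) = enorm (vsval u - vsval v).

Definition convex_body {n : nat} (K : set 'rV[R]_n) : Prop :=
  [/\ K !=set0, compact K & @convex_set R 'rV[R]_n K].

(* On a convex body this supremum is a maximum, see support_fun_max. *)
Definition support_fun {n : nat} (K : set 'rV[R]_n) (x : 'rV[R]_n) : R :=
  sup [set dot x y | y in K].

Lemma dot_continuous {n : nat} (x : 'rV[R]_n) : continuous (dot x).
Proof.
rewrite /dot; apply: continuous_big => [|i _ y]; first exact: add_continuous.
by apply: continuousM; [exact: cst_continuous|exact: coord_continuous].
Qed.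

Lemma support_fun_max {n : nat} (K : set 'rV[R]_n) (x : 'rV[R]_n) :
  convex_body K ->
  exists y, [/\ K y, support_fun K x = dot x y &
    forall z, K z -> dot x z <= dot x y].
Proof.
move=> [K0 cK _].
have [|y Ky ymax] := @EVT_max_rV R n (dot x) K K0 cK.
  by apply: continuous_subspaceT; exact: dot_continuous.
have ym z : K z -> dot x z <= dot x y by move=> Kz; apply: ymax; rewrite inE.
have {}Ky : K y by rewrite inE in Ky.
exists y; split => //; apply/eqP; rewrite eq_le; apply/andP; split.
  by apply: ge_sup; [exists (dot x y), y|move=> _ [z Kz <-]; exact: ym].
by apply: ub_le_sup; [exists (dot x y) => _ [z Kz <-]; exact: ym|exists y].
Qed.

End Euclidean.

Section Gaussian.
Context {R : realType} {disp : measure_display} {T : measurableType disp}.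
Context (P : probability T R).

Definition mutually_independent {n : nat} (Z : 'I_n -> {RV P >-> R}) : Prop :=
  forall (J : {set 'I_n}) (A : 'I_n -> set R),
    (forall i, measurable (A i)) ->
    P (\bigcap_(i in [set` J]) (Z i @^-1` A i)) =
    (\prod_(i in J) P (Z i @^-1` A i))%E.

(* The laws are compared on measurable sets only: the values of a measure
   elsewhere are unspecified. *)
Definition standard_gaussian (X : {RV P >-> R}) : Prop :=
  forall A : set R, measurable A -> distribution P X A = normal_prob 0 1 A.

Definition standard_gaussian_vector {n : nat} (Z : 'I_n -> {RV P >-> R}) : Prop :=
  mutually_independent Z /\ (forall i, standard_gaussian (Z i)).

Definition random_row {n : nat} (Z : 'I_n -> {RV P >-> R}) (w : T) : 'rV[R]_n :=
  \row_(i < n) Z i w.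

End Gaussian.

Definition gaussian_abs_moment {R : realType} (p : R) : \bar R :=
  'E_(normal_prob (0 : R) 1)[fun z : R => `|z| `^ p].

(* Real p-th powers are powR/poweR; the value is left in \bar R, like every
   expectation, so that no infinite value is collapsed. *)
Definition intrinsic_Lp_metric {R : realType} {disp : measure_display}
    {T : measurableType disp} (P : probability T R) {n : nat}
    (Z : 'I_n -> {RV P >-> R}) (p : R) (K L : set 'rV[R]_n) : \bar R :=
  (((gaussian_abs_moment p)^-1 *
    'E_P[fun w => (`|support_fun K (random_row Z w) -
                     support_fun L (random_row Z w)| `^ p)%R]) `^ p^-1)%E.

(* Main.v *)
(* For y in S we have <x, y> = <sigma x, sigma y>, hence h_K(x) = h_{sigma K}(sigma x),
   and it remains to see that sigma maps the standard Gaussian law of R^d to that of R^m.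
   In coordinates sigma is x |-> (<x, a_l>)_l with a_1, ..., a_m orthonormal, and
   reflections in coordinate planes turn these vectors into the first m vectors of the
   standard basis.  Such a reflection preserves the Gaussian law of R^d because it
   preserves both the density exp(-|x|^2/2) and the Lebesgue measure of the plane, being
   a product of shears and a sign change.  A law on R^n is determined by its values on
   boxes, so the law of Z^(n) is handled through those values only. *)
Require Import Defs.
From HB Require Import structures.
From mathcomp Require Import all_boot all_order all_algebra.
From mathcomp Require Import all_classical all_reals all_analysis.
From mathcomp Require Import measurable_realfun ring.
Set Implicit Arguments.
Unset Strict Implicit.
Unset Printing Implicit Defensive.
Import Order.TTheory GRing.Theory Num.Theory.
Import numFieldNormedType.Exports.
Local Open Scope classical_set_scope.
Local Open Scope ring_scope.

(** * Plane maps preserving Lebesgue measure *)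

Section PlaneLebesgue.
Context {R : realType}.
Local Notation mu := (@lebesgue_measure R).
Local Notation mu2 := (mu \x mu)%E.
Implicit Types (a c s t : R) (f : R * R -> \bar R).
Local Open Scope ereal_scope.

(** Translation keeps the length of intervals, and these lengths determine Lebesgue measure. *)
Lemma lebesgue_measureD a (A : set R) : measurable A ->
  pushforward mu ((fun x => x + a)%R : _ -> measurableTypeR R) A = mu A.
Proof.
have ma : measurable_fun [set: measurableTypeR R]
  ((fun x => x + a)%R : _ -> measurableTypeR R) by exact: measurable_funD.
move=> mA; apply/esym/lebesgue_measure_unique => //= _ [[x y] _ <-].
rewrite /pushforward [X in _ = lebesgue_measure X](_ : _ =
    `](x - a)%R, (y - a)%R]%classic).
  rewrite !lebesgue_measure_itv/= !lte_fin ltrD2r.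
  by case: ifP => // _; rewrite -!EFinB; congr EFin; ring.
by apply/seteqP; split=> z /=; rewrite !in_itv/= ltrBlDr lerBrDr.
Qed.

Lemma ge0_integral_shift a (g : R -> \bar R) : measurable_fun setT g ->
  (forall x, 0 <= g x) -> \int[mu]_x g (x + a)%R = \int[mu]_x g x.
Proof.
move=> mg g0.
have ma : measurable_fun [set: measurableTypeR R]
  ((fun x => x + a)%R : _ -> measurableTypeR R) by exact: measurable_funD.
rewrite -[LHS](@ge0_integral_pushforward _ _ _ _ _ _ ma mu setT g)//.
by apply: eq_measure_integral => A mA _; exact: lebesgue_measureD.
Qed.

Lemma ge0_integral_opp (g : R -> \bar R) : measurable_fun setT g ->
  (forall x, 0 <= g x) -> \int[mu]_x g (- x)%R = \int[mu]_x g x.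
Proof.
move=> mg g0.
have ma : measurable_fun [set: measurableTypeR R]
  (-%R : _ -> measurableTypeR R) by exact: oppr_measurable.
rewrite -[LHS](@ge0_integral_pushforward _ _ _ _ _ _ ma mu setT g)//.
by apply: eq_measure_integral => A mA _; exact: lebesgue_measureN.
Qed.

Lemma measurable_lincomb2 a b :
  measurable_fun setT (fun z : R * R => a * z.1 + b * z.2)%R.
Proof. by apply: measurable_funD; apply: measurable_funM. Qed.

(** Invariance is phrased through integrals of nonnegative functions rather than preimages of sets:
    Tonelli then treats one variable at a time. *)
Definition plane_invariant (T : R * R -> R * R) : Prop :=
  measurable_fun setT T /\ forall f, measurable_fun setT f ->
    (forall z, 0 <= f z) -> \int[mu2]_z f (T z) = \int[mu2]_z f z.

Lemma plane_invariant_comp (T1 T2 : R * R -> R * R) :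
  plane_invariant T1 -> plane_invariant T2 -> plane_invariant (T1 \o T2).
Proof.
move=> [mT1 iT1] [mT2 iT2]; split; first exact: measurableT_comp.
move=> f mf f0; rewrite -(iT1 f)//; apply: (iT2 (f \o T1)) => [|z /=].
  exact: measurableT_comp.
exact: f0.
Qed.

(** By Tonelli, invariance may be checked on each line where [y] is fixed. The affine shape
    [g y * x + h y] covers shears and sign changes alike. *)
Lemma plane_invariant_fst (g h : R -> R) :
  measurable_fun setT (fun z : R * R => (g z.2 * z.1 + h z.2, z.2)%R) ->
  (forall y (k : R -> \bar R), measurable_fun setT k -> (forall x, 0 <= k x) ->
    \int[mu]_x k (g y * x + h y)%R = \int[mu]_x k x) ->
  plane_invariant (fun z => (g z.2 * z.1 + h z.2, z.2)%R).
Proof.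
move=> mT gh; split => // f mf f0.
rewrite fubini_tonelli2//; last exact: measurableT_comp.
rewrite fubini_tonelli2//; apply: eq_integral => y _; rewrite /fubini_G/=.
rewrite (gh y (fun x => f (x, y)))//.
by apply: measurableT_comp => //; exact: measurable_fun_pair.
Qed.

Lemma plane_invariant_snd (g h : R -> R) :
  measurable_fun setT (fun z : R * R => (z.1, g z.1 * z.2 + h z.1)%R) ->
  (forall x (k : R -> \bar R), measurable_fun setT k -> (forall y, 0 <= k y) ->
    \int[mu]_y k (g x * y + h x)%R = \int[mu]_y k y) ->
  plane_invariant (fun z => (z.1, g z.1 * z.2 + h z.1)%R).
Proof.
move=> mT gh; split => // f mf f0.
rewrite fubini_tonelli1//; last exact: measurableT_comp.
rewrite fubini_tonelli1//; apply: eq_integral => x _; rewrite /fubini_F/=.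
rewrite (gh x (fun y => f (x, y)))//.
by apply: measurableT_comp => //; exact: measurable_fun_pair.
Qed.

Lemma plane_invariant_ext (T1 T2 : R * R -> R * R) : T1 =1 T2 ->
  plane_invariant T1 -> plane_invariant T2.
Proof. by move=> /funext ->. Qed.

Lemma plane_invariant_shear_fst t :
  plane_invariant (fun z => (z.1 + t * z.2, z.2)%R).
Proof.
apply: (@plane_invariant_ext (fun z => (1 * z.1 + t * z.2, z.2)%R)).
  by move=> z; rewrite mul1r.
apply: (@plane_invariant_fst (cst 1%R) (fun y => t * y)%R) => [|y k mk k0].
  by apply: measurable_fun_pair => //; exact: measurable_lincomb2.
under eq_integral do rewrite /= mul1r.
exact: ge0_integral_shift.
Qed.

Lemma plane_invariant_shear_snd t :
  plane_invariant (fun z => (z.1, z.2 + t * z.1)%R).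
Proof.
apply: (@plane_invariant_ext (fun z => (z.1, 1 * z.2 + t * z.1)%R)).
  by move=> z; rewrite mul1r.
apply: (@plane_invariant_snd (cst 1%R) (fun x => t * x)%R) => [|x k mk k0].
  apply: measurable_fun_pair => //.
  by under eq_fun do rewrite addrC; exact: measurable_lincomb2.
under eq_integral do rewrite /= mul1r.
exact: ge0_integral_shift.
Qed.

Lemma plane_invariant_opp_fst : plane_invariant (fun z => (- z.1, z.2)%R).
Proof.
apply: (@plane_invariant_ext (fun z => (-1 * z.1 + 0, z.2)%R)).
  by move=> z; rewrite mulN1r addr0.
apply: (@plane_invariant_fst (cst (-1)%R) (cst 0%R)) => [|y k mk k0].
  by apply: measurable_fun_pair => //; apply: measurable_funD => //;
    apply: measurable_funM.
under eq_integral do rewrite /= mulN1r addr0.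
exact: ge0_integral_opp.
Qed.

Lemma plane_invariant_opp_snd : plane_invariant (fun z => (z.1, - z.2)%R).
Proof.
apply: (@plane_invariant_ext (fun z => (z.1, -1 * z.2 + 0)%R)).
  by move=> z; rewrite mulN1r addr0.
apply: (@plane_invariant_snd (cst (-1)%R) (cst 0%R)) => [|x k mk k0].
  by apply: measurable_fun_pair => //; apply: measurable_funD => //;
    apply: measurable_funM.
under eq_integral do rewrite /= mulN1r addr0.
exact: ge0_integral_opp.
Qed.

Lemma plane_invariant_reflection c s : (c ^+ 2 + s ^+ 2 = 1)%R ->
  plane_invariant (fun z => (c * z.1 + s * z.2, s * z.1 - c * z.2)%R).
Proof.
(* The shear factor [t] below divides by [s]. When [s = 0], [c] is 1 or -1 and the map only changes
   one sign. *)
move=> cs1; have [s0|s0] := eqVneq s 0%R.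
  have /orP[/eqP c1|/eqP c1] : (c == 1)%R || (c == -1)%R.
  - by rewrite -sqrf_eq1 -cs1 s0 expr0n addr0.
  - apply: plane_invariant_ext plane_invariant_opp_snd => z /=.
    by rewrite s0 c1 !mul0r !mul1r addr0 add0r.
  - apply: plane_invariant_ext plane_invariant_opp_fst => z /=.
    by rewrite s0 c1 !mul0r !mulN1r addr0 add0r opprK.
(* A rotation is a product of three shears. *)
pose t := ((1 - c) / s)%R.
(* The product of shears has entries [1 - t * s] and [t * (1 + (1 - t * s))]; [ts] and [tc] identify
   them with [c] and [s]. *)
have ts : (t * s = 1 - c)%R by rewrite /t divfK.
have tc : (t * (1 + c) = s)%R.
  by apply: (mulIf s0); rewrite mulrAC ts -expr2 -[RHS](addrK (c ^+ 2)%R)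
    [(s ^+ 2 + _)%R]addrC cs1; ring.
apply: plane_invariant_ext (plane_invariant_comp plane_invariant_opp_snd
  (plane_invariant_comp (plane_invariant_shear_fst t)
  (plane_invariant_comp (plane_invariant_shear_snd (- s))
    (plane_invariant_shear_fst t)))) => -[x y] /=.
congr pair.
  transitivity ((1 - t * s) * x + (t * (1 + (1 - t * s))) * y)%R; first by ring.
  by rewrite ts (_ : 1 + (1 - (1 - c)) = 1 + c)%R ?tc; [congr (_ + _)%R|];
    ring.
transitivity (s * x - (1 - t * s) * y)%R; first by ring.
by rewrite ts; ring.
Qed.

End PlaneLebesgue.

(** * The standard Gaussian measure of the plane *)

Section GaussianPlane.
Context {R : realType}.
Local Notation mu := (@lebesgue_measure R).
Local Notation mu2 := (mu \x mu)%E.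
Local Notation phi := (normal_pdf (0 : R) 1).
Local Notation gamma := (normal_prob (0 : R) 1).
Local Open Scope ereal_scope.

(** Given by its density rather than as a product of two copies of [gamma], so that invariance of
    the Lebesgue measure of the plane applies directly. *)
Definition gauss_plane (B : set (R * R)) : \bar R :=
  \int[mu2]_(z in B) (phi z.1 * phi z.2)%:E.

Let mdens : measurable_fun setT (fun z : R * R => (phi z.1 * phi z.2)%:E).
Proof.
apply/measurable_EFinP; apply: measurable_funM.
  by apply: measurableT_comp measurable_fst; exact: measurable_normal_pdf.
by apply: measurableT_comp measurable_snd; exact: measurable_normal_pdf.
Qed.

Let dens_ge0 (z : R * R) : 0 <= (phi z.1 * phi z.2)%:E.
Proof. by rewrite lee_fin mulr_ge0// normal_pdf_ge0. Qed.

Let gauss_plane0 : gauss_plane set0 = 0.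
Proof. exact: integral_set0. Qed.

Let gauss_plane_ge0 B : 0 <= gauss_plane B.
Proof. by apply: integral_ge0 => z _; exact: dens_ge0. Qed.

Let gauss_plane_sigma_additive : semi_sigma_additive gauss_plane.
Proof.
move=> F mF tF mUF.
rewrite /gauss_plane ge0_integral_bigcup//; last exact: measurable_funTS.
by apply: is_cvg_ereal_nneg_natsum_cond => n _ _; exact: gauss_plane_ge0.
Qed.

HB.instance Definition _ := isMeasure.Build _ _ _ gauss_plane
  gauss_plane0 gauss_plane_ge0 gauss_plane_sigma_additive.

(** The density and the indicator of a rectangle both split into one factor per variable, so Tonelli
    separates the integral. *)
Lemma gauss_planeX (A B : set R) : measurable A -> measurable B ->
  gauss_plane (A `*` B) = gamma A * gamma B.
Proof.
move=> mA mB.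
have mphi (C : set R) : measurable C ->
    measurable_fun setT (fun x => (phi x * \1_C x)%:E).
  move=> mC; apply/measurable_EFinP/measurable_funM => //.
  exact: measurable_normal_pdf.
have phi0 (C : set R) x : 0 <= (phi x * \1_C x)%:E.
  by rewrite lee_fin mulr_ge0// normal_pdf_ge0.
have gammaE (C : set R) : gamma C = \int[mu]_x (phi x * \1_C x)%:E.
  rewrite /normal_prob integral_mkcond; apply: eq_integral => x _.
  by rewrite patchE indicE; case: (x \in C); rewrite ?mulr1 ?mulr0.
rewrite /gauss_plane integral_mkcond.
rewrite (_ : _ \_ _ = fun z : R * R =>
    (phi z.1 * \1_A z.1)%:E * (phi z.2 * \1_B z.2)%:E); last first.
  apply/funext => -[x y]; rewrite patchE in_setX/= !indicE.
  by case: (x \in A); case: (y \in B);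
    rewrite /= ?mulr1 ?mulr0 -?EFinM ?mulr0 ?mul0r.
rewrite fubini_tonelli1; last 2 first.
- by apply: emeasurable_funM;
    [apply: measurableT_comp (mphi A mA) measurable_fst
    |apply: measurableT_comp (mphi B mB) measurable_snd].
- by move=> z; exact: mule_ge0.
under eq_integral => x _.
  rewrite /fubini_F/= ge0_integralZl//; last exact: mphi.
  rewrite -gammaE; over.
by rewrite ge0_integralZr//; [rewrite -gammaE|exact: mphi].
Qed.

(** The density depends only on [x ^+ 2 + y ^+ 2], which the reflection preserves along with
    Lebesgue measure. *)
Lemma gauss_plane_reflection (c s : R) (B : set (R * R)) :
  (c ^+ 2 + s ^+ 2 = 1)%R -> measurable B ->
  gauss_plane ((fun z => (c * z.1 + s * z.2, s * z.1 - c * z.2)%R) @^-1` B) =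
  gauss_plane B.
Proof.
move=> cs1 mB; rewrite /gauss_plane integral_mkcond [RHS]integral_mkcond.
have [_ inv] := plane_invariant_reflection cs1; rewrite -[RHS]inv.
- apply: eq_integral => -[x y] _; rewrite !patchE.
  rewrite (_ : (_ \in _) = ((c * x + s * y, s * x - c * y)%R \in B)); last first.
    by apply/idP/idP => /set_mem h; exact: mem_set.
  case: ifP => // _; congr EFin; rewrite /= /normal_pdf oner_eq0.
  rewrite /normal_fun !subr0 mulrACA [RHS]mulrACA -!expRD; congr (_ * expR _)%R.
  rewrite -!mulrDl; congr (_ / _)%R.
  transitivity (- ((c ^+ 2 + s ^+ 2) * (x ^+ 2 + y ^+ 2)))%R; last by ring.
  by rewrite cs1; ring.
- by apply/(measurable_restrictT _ _).1 => //; exact: measurable_funTS mdens.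
- by move=> z; rewrite patchE; case: ifP => // _; exact: dens_ge0.
Qed.

End GaussianPlane.

(** * Laws on tuples *)

Section GaussianLaw.
Context {R : realType}.
Local Notation gamma := (normal_prob (0 : R) 1).
Local Open Scope ereal_scope.

Definition box {n} (A : 'I_n -> set R) : set (n.-tuple R) :=
  [set t | forall i, A i (tnth t i)].

(** These are the values of the product of [n] copies of [gamma]. Any set function is allowed, so a
    pushforward can be mentioned before its measurability proof is supplied. *)
Definition gaussian_law {n} (nu : set (n.-tuple R) -> \bar R) : Prop :=
  forall A : 'I_n -> set R, (forall i, measurable (A i)) ->
    nu (box A) = \prod_(i < n) gamma (A i).

Lemma measurable_box n (A : 'I_n -> set R) :
  (forall i, measurable (A i)) -> measurable (box A).
Proof.
move=> mA; rewrite (_ : box A =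
    \bigcap_(i in [set: 'I_n]) ((@tnth n R ^~ i) @^-1` A i)).
  apply: fin_bigcap_measurable => // i _; rewrite -[X in measurable X]setTI.
  exact: measurable_tnth.
by apply/seteqP; split=> t At i //=; exact: At.
Qed.

Lemma measurable_tuple_boxE n : @measurable _ (n.-tuple R) =
  <<s [set box A | A in [set A : 'I_n -> set R | forall i, measurable (A i)]] >>.
Proof.
apply/seteqP; split.
  apply: smallest_sub; first exact: smallest_sigma_algebra.
  rewrite -bigcup_seq => B [i _ [C mC <-]]; apply: sub_sigma_algebra.
  (* A condition on one coordinate is a box whose other sides are the whole line. *)
  exists (fun k => if k == i then C else setT).
    by move=> k /=; case: ifP.
  apply/seteqP; split=> [t /(_ i)|t [_ Ct] k] /=; first by rewrite eqxx.
  by case: eqP => // ->.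
apply: smallest_sub; first exact: sigma_algebra_measurable.
by move=> _ [A mA <-]; exact: measurable_box.
Qed.

(** Boxes generate the sigma-algebra and are stable under intersection, and the full box has finite
    mass. *)
Lemma gaussian_law_unique n (nu1 nu2 : {measure set (n.-tuple R) -> \bar R}) :
  gaussian_law nu1 -> gaussian_law nu2 ->
  forall B, measurable B -> nu1 B = nu2 B.
Proof.
move=> g1 g2 B mB; apply: (measure_unique _ (fun=> box (fun=> setT))
  (measurable_tuple_boxE n)) => //.
- move=> _ _ [A1 mA1 <-] [A2 mA2 <-]; exists (fun i => A1 i `&` A2 i).
    by move=> i; apply: measurableI; [exact: mA1|exact: mA2].
  apply/seteqP; split=> [t At|t [At1 At2] i]; last by split.
  by split=> i; have [] := At i.
- by move=> _; exists (fun=> setT).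
- by rewrite bigcup_const//; apply/seteqP; split.
- by move=> _ [A mA <-]; rewrite g1// g2.
- by move=> _; rewrite g1// big1 ?ltry// => i _; exact: probability_setT.
Qed.

Lemma measure_plane_unique (m1 m2 : {measure set (R * R) -> \bar R}) :
  (forall A B, measurable A -> measurable B -> m1 (A `*` B) = m2 (A `*` B)) ->
  m1 setT < +oo -> forall C, measurable C -> m1 C = m2 C.
Proof.
move=> m12 m1T C mC; apply: (measure_unique
  [set A `*` B | A in measurable & B in measurable] (fun=> setT)) => //.
- exact: measurable_prod_measurableType.
- move=> _ _ [A1 mA1 [B1 mB1 <-]] [A2 mA2 [B2 mB2 <-]].
  exists (A1 `&` A2); first exact: measurableI.
  by exists (B1 `&` B2); [exact: measurableI|rewrite setXI].
- by move=> _; exists setT => //; exists setT => //; rewrite setXTT.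
- by rewrite bigcup_const.
- by move=> _ [A mA [B mB <-]]; exact: m12.
Qed.

End GaussianLaw.

(** * Reflections in coordinate planes *)

Section Reflection.
Context {R : realType} {n : nat}.
Implicit Types (x y : 'rV[R]_n) (i j : 'I_n) (c s : R).

(** The block acting on coordinates [i] and [j] is symmetric, unlike that of a general rotation; for
    [i != j] and [(c, s)] of length 1 the map is its own adjoint and its own inverse. *)
Definition reflect i j c s x : 'rV[R]_n :=
  \row_k (if k == i then c * x 0 i + s * x 0 j
          else if k == j then s * x 0 i - c * x 0 j else x 0 k).

Lemma dot_split2 i j x y : i != j ->
  dot x y = x 0 i * y 0 i +
    (x 0 j * y 0 j + \sum_(k | (k != i) && (k != j)) x 0 k * y 0 k).
Proof. by move=> ij; rewrite /dot (bigD1 i)//= (bigD1 j)//= eq_sym. Qed.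

Lemma dot_reflect_rest i j c s x y :
  \sum_(k | (k != i) && (k != j)) reflect i j c s x 0 k * y 0 k =
  \sum_(k | (k != i) && (k != j)) x 0 k * y 0 k.
Proof.
by apply: eq_bigr => k /andP[/negPf ki /negPf kj]; rewrite mxE ki kj.
Qed.

Lemma dotC x y : dot x y = dot y x.
Proof. by apply: eq_bigr => k _; rewrite mulrC. Qed.

Lemma dot_reflect_adj i j c s x y : i != j ->
  dot (reflect i j c s x) y = dot x (reflect i j c s y).
Proof.
move=> ij; rewrite (dot_split2 _ _ ij) dot_reflect_rest.
rewrite [RHS]dotC (dot_split2 _ _ ij) dot_reflect_rest !mxE eqxx.
rewrite eq_sym (negPf ij) eqxx.
under [in RHS]eq_bigr do rewrite mulrC.
by rewrite !addrA; congr (_ + _); ring.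
Qed.

Lemma reflectK i j c s : i != j -> c ^+ 2 + s ^+ 2 = 1 ->
  involutive (reflect i j c s).
Proof.
move=> ij cs1 x; apply/rowP => k; rewrite !mxE !eqxx (eq_sym j) (negPf ij).
have [->|_] := eqVneq k i.
  transitivity ((c ^+ 2 + s ^+ 2) * x 0 i); first by ring.
  by rewrite cs1 mul1r.
have [->|//] := eqVneq k j.
transitivity ((c ^+ 2 + s ^+ 2) * x 0 j); first by ring.
by rewrite cs1 mul1r.
Qed.

Lemma dot_reflect i j c s x y : i != j -> c ^+ 2 + s ^+ 2 = 1 ->
  dot (reflect i j c s x) (reflect i j c s y) = dot x y.
Proof. by move=> ij cs1; rewrite dot_reflect_adj// reflectK. Qed.

End Reflection.

(** * Invariance of the Gaussian law under reflections *)

Section GaussianReflection.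
Context {R : realType} {n : nat}.
Local Notation gamma := (normal_prob (0 : R) 1).
Local Open Scope ereal_scope.

Definition row_of (t : n.-tuple R) : 'rV[R]_n := \row_k tnth t k.

Definition reflect_tuple (i j : 'I_n) (c s : R) (t : n.-tuple R) : n.-tuple R :=
  [tuple reflect i j c s (row_of t) 0%R k | k < n].

Lemma row_of_reflect i j c s t :
  row_of (reflect_tuple i j c s t) = reflect i j c s (row_of t).
Proof. by apply/rowP => k; rewrite mxE tnth_mktuple. Qed.

Lemma measurable_reflect_tuple i j c s :
  measurable_fun setT (reflect_tuple i j c s).
Proof.
apply/measurable_fun_tnthP => k; rewrite /comp/=.
under eq_fun do rewrite tnth_mktuple !mxE.
case: (k == i); [|case: (k == j)].
- by apply: measurable_funD; apply: measurable_funM => //; exact: measurable_tnth.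
- by apply: measurable_funB; apply: measurable_funM => //; exact: measurable_tnth.
- exact: measurable_tnth.
Qed.

(** With the other coordinates confined to their sides, the pair of coordinates [i] and [j] is
    distributed as a multiple of [gauss_plane], whose invariance gives the claim. *)
Lemma gaussian_law_reflect (nu : {measure set (n.-tuple R) -> \bar R}) i j c s :
  i != j -> (c ^+ 2 + s ^+ 2 = 1)%R -> gaussian_law nu ->
  gaussian_law (pushforward nu (reflect_tuple i j c s)).
Proof.
move=> ij cs1 gnu A mA.
(* [E] constrains every coordinate except [i] and [j]; [k0] below is its Gaussian mass. *)
pose E := box (fun k => if (k == i) || (k == j) then setT else A k).
have mE : measurable E by apply: measurable_box => k; case: ifP.
pose p (t : n.-tuple R) := (tnth t i, tnth t j).
have mp : measurable_fun setT p.
  by apply: measurable_fun_pair; exact: measurable_tnth.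
pose k0 := \prod_(k | (k != i) && (k != j)) gamma (A k).
have k0_ge0 : 0 <= k0 by apply: prode_ge0.
have k0_fin : k0 \is a fin_num.
  by apply: prode_fin_num => k _; apply: fin_num_measure; exact: mA.
have fk0 : (0 <= fine k0)%R by rewrite fine_ge0.
have prodE (B : 'I_n -> set R) : (forall k, k != i -> k != j -> B k = A k) ->
    \prod_(k < n) gamma (B k) = k0 * (gamma (B i) * gamma (B j)).
  move=> BA; rewrite (bigD1 i)//= (bigD1 j) 1?eq_sym//= muleA muleC.
  by congr (_ * _); apply: eq_bigr => k /andP[ki kj]; rewrite BA.
(* [m1] takes the measurability proof required by the pushforward instance. *)
pose m1 : {measure set (R * R) -> \bar R} := pushforward (mrestr nu mE) p.
have m1E (B1 B2 : set R) : measurable B1 -> measurable B2 ->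
    m1 mp (B1 `*` B2) = k0 * gauss_plane (B1 `*` B2).
  move=> mB1 mB2; rewrite gauss_planeX//=.
  pose B k := if k == i then B1 else if k == j then B2 else A k.
  have mB k : measurable (B k) by rewrite /B; case: ifP => //; case: ifP.
  transitivity (nu (box B)).
    rewrite /pushforward /mrestr; congr (nu _); apply/seteqP; split.
      move=> t [[/= Bi Bj] Et] k; rewrite /B; have := Et k.
      by have [->//|_] := eqVneq k i; have [->|_] := eqVneq k j.
    move=> t Bt; split=> [|k]; first split=> /=.
    - by have := Bt i; rewrite /B eqxx.
    - by have := Bt j; rewrite /B eqxx eq_sym (negPf ij).
    - by have := Bt k; rewrite /B; case: eqP => //; case: eqP.
  rewrite gnu// prodE; last by move=> k /negPf ki /negPf kj; rewrite /B ki kj.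
  by rewrite /B !eqxx eq_sym (negPf ij).
(* The identity extends from rectangles to all measurable sets by uniqueness. The scalar of [mscale]
   is a nonnegative real, hence [fine k0]. *)
have m1P C : measurable C -> m1 mp C = k0 * gauss_plane C.
  pose m2 : {measure set (R * R) -> \bar R} :=
    mscale (NngNum fk0) gauss_plane.
  have m2E C' : m2 C' = k0 * gauss_plane C'.
    by rewrite /m2/= /mscale/= fineK.
  rewrite -m2E; apply: measure_plane_unique => [B1 B2 mB1 mB2|].
    by rewrite m2E m1E.
  rewrite -setXTT m1E// gauss_planeX// !probability_setT !mule1.
  by rewrite ltey_eq k0_fin.
pose refl (z : R * R) := (c * z.1 + s * z.2, s * z.1 - c * z.2)%R.
(* The reflection mixes only coordinates [i] and [j], so the preimage of the box is [E] cut by a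
   condition on that pair. *)
transitivity (m1 mp (refl @^-1` (A i `*` A j))).
  rewrite /= /pushforward /mrestr; congr (nu _); apply/seteqP; split.
    move=> t At; split=> [|k]; first split=> /=.
    - by have := At i; rewrite tnth_mktuple !mxE eqxx.
    - by have := At j; rewrite tnth_mktuple !mxE eqxx eq_sym (negPf ij).
    - have := At k; rewrite tnth_mktuple !mxE.
      by case: eqP => //; case: eqP.
  move=> t [[/= Ai Aj] Et] k; rewrite tnth_mktuple !mxE.
  have := Et k.
  by have [->//|_] := eqVneq k i; have [->|_] := eqVneq k j.
rewrite m1P; last first.
  rewrite -[X in measurable X]setTI.
  by apply: (plane_invariant_reflection cs1).1 => //; exact: measurableX.
by rewrite gauss_plane_reflection ?gauss_planeX ?prodE//; exact: measurableX.
Qed.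

End GaussianReflection.

(** * Orthonormal families *)

(** Normalising [(x, y)] to [(c, s)] gives the reflection that sends it to [(r, 0)]; at the origin
    any unit vector serves. *)
Lemma plane_reflection_exists (R : realType) (x y : R) : exists c s : R,
  [/\ c ^+ 2 + s ^+ 2 = 1, 0 <= c * x + s * y & s * x - c * y = 0].
Proof.
pose r := Num.sqrt (x ^+ 2 + y ^+ 2).
have xy0 : 0 <= x ^+ 2 + y ^+ 2 by rewrite addr_ge0// sqr_ge0.
have r2 : r ^+ 2 = x ^+ 2 + y ^+ 2 by rewrite sqr_sqrtr.
have [r0|r0] := eqVneq r 0.
  move: r2; rewrite r0 expr0n/= => /esym/eqP.
  rewrite paddr_eq0 ?sqr_ge0// !sqrf_eq0 => /andP[/eqP -> /eqP ->].
  by exists 1, 0; split=> //; rewrite ?mulr0 ?addr0 ?subr0// expr1n expr0n addr0.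
exists (x / r), (y / r); split.
- by rewrite !expr_div_n -mulrDl -r2 divff// sqrf_eq0.
- rewrite (_ : _ + _ = (x ^+ 2 + y ^+ 2) / r); last by field.
  by rewrite divr_ge0// sqrtr_ge0.
- by field.
Qed.

Section OrthonormalFamilies.
Context {R : realType} {d m : nat}.
Implicit Types a : 'I_m -> 'rV[R]_d.

Definition orthonormal_family a : Prop :=
  forall l l', dot (a l) (a l') = (l == l')%:R.

Definition std_below (k : nat) a : Prop :=
  forall (l : 'I_m) (q : 'I_d), (l < k)%N -> a l 0 q = (q == l :> nat)%:R.

(* Plane reflections clear the entries of the [k]-th vector one at a time, and
   leave alone the earlier vectors, already equal to standard basis vectors. *)
Lemma orthonormal_family_ind (Q : ('I_m -> 'rV[R]_d) -> Prop) :
  (m < d)%N ->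
  (forall a i j c s, i != j -> c ^+ 2 + s ^+ 2 = 1 ->
    Q (fun l => reflect i j c s (a l)) -> Q a) ->
  (forall a, std_below m a -> Q a) ->
  forall a, orthonormal_family a -> Q a.
Proof.
move=> md Qr Qs a oa.
(* Outer induction on the number [e] of vectors not yet standard. *)
suff H e k : (k + e = m)%N ->
    forall a, orthonormal_family a -> std_below k a -> Q a.
  by apply: (H m 0%N) => // l q; rewrite ltn0.
elim: e k => [|e IHe] k kem {}a {}oa sa; first by apply: Qs; rewrite -kem addn0.
have km : (k < m)%N by rewrite -kem addnS ltnS leq_addr.
have kd : (k < d)%N by exact: (ltn_trans km md).
pose lk := Ordinal km; pose ik := Ordinal kd.
(* Inner induction on the [r] entries still to clear: those strictly between [k] and [nn] vanish.
   The sign of entry [k] is guaranteed only after one reflection, that is when [k.+1 < nn]. *)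
suff H r nn : (nn + r = d)%N -> (k < nn)%N ->
    forall a, orthonormal_family a -> std_below k a ->
    (forall q : 'I_d, (k < q < nn)%N -> a lk 0 q = 0) ->
    ((k.+1 < nn)%N -> 0 <= a lk 0 ik) -> Q a.
  apply: (H (d - k.+1)%N k.+1) => //; first by rewrite subnKC.
    by move=> q; rewrite ltnS; case: ltngtP.
  by rewrite ltnn.
elim: r nn => [|r IHr] nn nrd knn {}a {}oa {}sa za a_ge0.
  rewrite addn0 in nrd; subst nn.
  apply: (IHe k.+1) => //; first by rewrite addSnnS.
  (* Entries before [k] vanish by orthogonality to the earlier vectors, which are standard; those
     after [k] have been cleared. *)
  have lkq (q : 'I_d) : q != ik -> a lk 0 q = 0.
    move=> qk; have [qk'|kq|qk'] := ltngtP q k.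
    - have qm : (q < m)%N by exact: (ltn_trans qk' km).
      have := oa lk (Ordinal qm).
      rewrite /dot (bigD1 q)//= big1 => [|p pq].
        rewrite [X in _ * X]sa//= eqxx mulr1 addr0 => ->.
        by rewrite -val_eqE/= gtn_eqF.
      by rewrite [X in _ * X]sa//= (_ : (p == q :> nat) = false) ?mulr0//;
        exact: negbTE.
    - by rewrite za// kq ltn_ord.
    - by move/eqP: qk; case; exact: val_inj.
  (* Unit length leaves 1 or -1. As [k < m < d], at least one reflection was made, so the sign is
     nonnegative. *)
  have lkk : a lk 0 ik = 1.
    have := oa lk lk; rewrite eqxx /dot (bigD1 ik)//= big1 => [|p pk].
      rewrite addr0 -expr2 => /eqP; rewrite sqrf_eq1 => /orP[/eqP //|/eqP a1].
      have := a_ge0 (leq_ltn_trans km md).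
      by rewrite a1 oppr_ge0 ler10.
    by rewrite lkq// mul0r.
  move=> l q; rewrite ltnS leq_eqVlt => /orP[/eqP lk'|]; last exact: sa.
  have -> : l = lk by exact: val_inj.
  have [->|qk] := eqVneq q ik; first by rewrite lkk eqxx.
  by rewrite lkq//= (_ : (_ == _) = false)//; exact: negbTE.
have nd : (nn < d)%N by rewrite -nrd addnS ltnS leq_addr.
pose jn := Ordinal nd.
have ij : ik != jn by rewrite -val_eqE/= ltn_eqF.
have [c [s [cs1 r_ge0 r0]]] := plane_reflection_exists (a lk 0 ik) (a lk 0 jn).
apply: (Qr _ ik jn c s) => //; apply: (IHr nn.+1).
- by rewrite addSnnS.
- exact: ltnW.
- by move=> l l'; rewrite dot_reflect.
- move=> l q lk'; rewrite mxE !sa//=.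
  rewrite (gtn_eqF lk') (gtn_eqF (ltn_trans lk' knn)) !mulr0 subr0 addr0.
  have [->|_] := eqVneq q ik; first by rewrite gtn_eqF.
  by have [->|_] := eqVneq q jn; first by rewrite gtn_eqF// (ltn_trans lk').
- move=> q /andP[kq qn]; rewrite mxE -val_eqE/= (gtn_eqF kq).
  have [_|qj] := eqVneq q jn; first by rewrite r0.
  rewrite za// kq ltn_neqAle -ltnS qn andbT.
  by apply: contra_neq qj => qn'; exact: val_inj.
- by move=> _; rewrite mxE eqxx.
Qed.

End OrthonormalFamilies.

(** * The Gaussian law under orthonormal coordinates *)

Section GaussianProjection.
Context {R : realType} {d m : nat}.
Local Notation gamma := (normal_prob (0 : R) 1).
Implicit Types a : 'I_m -> 'rV[R]_d.
Local Open Scope ereal_scope.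

Definition coords a (x : 'rV[R]_d) : m.-tuple R := [tuple dot x (a l) | l < m].

Lemma measurable_coords a : measurable_fun setT (coords a \o row_of).
Proof.
apply/measurable_fun_tnthP => l; rewrite /comp/=.
under eq_fun do rewrite tnth_mktuple.
apply: measurable_sum => i; apply: measurable_funM => //.
under eq_fun do rewrite mxE.
exact: measurable_tnth.
Qed.

(** Reflecting all the [a l] amounts to reflecting the argument, which leaves the law unchanged.
    This reduces to standard vectors, where [coords a] keeps the first [m] coordinates. *)
Lemma gaussian_law_coords (nu : {measure set (d.-tuple R) -> \bar R}) a :
  (m < d)%N -> orthonormal_family a -> gaussian_law nu ->
  gaussian_law (pushforward nu (coords a \o row_of)).
Proof.
move=> md oa gnu; move: a oa.
apply: orthonormal_family_ind => // [a i j c s ij cs1 Qa A mA|a sa A mA].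
  have mrefl := @measurable_reflect_tuple R d i j c s.
  pose nu' : {measure set (d.-tuple R) -> \bar R} :=
    pushforward nu (reflect_tuple i j c s).
  transitivity (nu' mrefl ((coords a \o row_of) @^-1` box A)).
    apply: (@gaussian_law_unique _ _ nu (nu' mrefl)) => //.
      exact: gaussian_law_reflect.
    rewrite -[X in measurable X]setTI; apply: measurable_coords => //.
    exact: measurable_box.
  rewrite -Qa// /pushforward/=; congr (nu _); apply/seteqP.
  by split=> t At l; have := At l;
    rewrite !tnth_mktuple row_of_reflect dot_reflect_adj.
(* The sides past the first [m] are the whole line and contribute factors 1. *)
pose B (q : 'I_d) : set R := if insub (q : nat) is Some l then A l else setT.
have mB q : measurable (B q) by rewrite /B; case: insub.
transitivity (nu (box B)).
  have coordsE t l : dot (row_of t) (a l) = tnth t (widen_ord (ltnW md) l).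
    rewrite /dot (bigD1 (widen_ord (ltnW md) l))//= big1 => [|q ql].
      by rewrite addr0 mxE sa// eqxx mulr1.
    by rewrite sa// (_ : (_ == _) = false) ?mulr0//; exact: negbTE.
  rewrite /pushforward; congr (nu _); apply/seteqP; split=> t At /=.
    move=> q; rewrite /B; case: insubP => [l _ lq|//].
    have := At l; rewrite tnth_mktuple coordsE.
    by congr (A l (tnth t _)); exact: val_inj.
  move=> l; have := At (widen_ord (ltnW md) l).
  by rewrite /B/= valK tnth_mktuple coordsE.
rewrite gnu// (bigID (fun q : 'I_d => q < m)%N)/= [X in _ * X]big1; last first.
  by move=> q qm; rewrite /B insubN// probability_setT.
rewrite mule1 (big_ord_narrow (ltnW md)); apply: eq_bigr => l _.
by rewrite /B/= valK.
Qed.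

End GaussianProjection.

(** * Measurability of support functions *)

Section SupportMeasurable.
Context {R : realType} {n : nat}.

(** An open set is a countable union of cubes with rational centres and radii [1/(k+1)], and each
    cube is a box. *)
Lemma measurable_row_of_open (U : set 'rV[R]_n) : open U ->
  measurable (row_of @^-1` U : set (n.-tuple R)).
Proof.
move=> oU.
pose cube (z : {ffun 'I_n -> rat} * nat) : set (n.-tuple R) :=
  box (fun i => ball (ratr (z.1 i) : R) z.2.+1%:R^-1).
(* Cubes not inside [U] are replaced by the empty set, so that the union runs over a whole countable
   type. *)
pose F z := if `[< cube z `<=` row_of @^-1` U >] then cube z else set0.
rewrite (_ : _ @^-1` _ = \bigcup_z F z).
  apply: countable_bigcupT_measurable => [|z]; first exact: countableP.
  rewrite /F; case: ifP => // _; apply: measurable_box => i.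
  exact: measurable_ball.
apply/seteqP; split=> [t Ut|t [z _]]; last first.
  by rewrite /F; case: asboolP => // zU /zU.
have /nbhs_ballP[e /= e0 teU] := open_nbhs_nbhs (conj oU Ut).
have e2 : 0 < e / 2 by rewrite divr_gt0.
(* A cube of radius below [e / 2] that contains [t] lies within [e] of [t]. *)
have [k] := ltr_add_invr e2; rewrite add0r => ke.
have k0 : 0 < k.+1%:R^-1 :> R by rewrite invr_gt0.
have q_ i : exists q : rat, ball (ratr q : R) k.+1%:R^-1 (tnth t i).
  have [|q] := @rat_in_itvoo R (tnth t i) (tnth t i + k.+1%:R^-1).
    by rewrite ltrDl.
  rewrite in_itv/= => /andP[q1 q2]; exists q; rewrite /ball/=.
  by rewrite ger0_norm ?subr_ge0 ?(ltW q1)// ltrBlDl.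
have [q tq] := choice q_.
exists ([ffun i => q i], k) => //; rewrite /F asboolT.
  by move=> i /=; rewrite ffunE.
move=> t' t'q; apply: teU; split=> // i j; rewrite !mxE.
have := t'q j; rewrite /= ffunE => t'j.
apply: (@le_ball _ _ _ (k.+1%:R^-1 + k.+1%:R^-1)).
  by rewrite [leRHS]splitr lerD// ltW.
exact: ball_triangle (ball_sym (tq j)) t'j.
Qed.

(** Since the supremum is attained, [support_fun K] exceeds [r] exactly on a union of open
    half-spaces. Assuming attainment alone lets the lemma apply to images under [iota \o proj]. *)
Lemma measurable_support_fun (K : set 'rV[R]_n) :
  (forall x, exists y, [/\ K y, support_fun K x = dot x y &
    forall z, K z -> dot x z <= dot x y]) ->
  measurable_fun setT (support_fun K \o row_of).
Proof.
move=> Kmax; apply: (measurability _ (RGenOInfty.measurableE R)).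
move=> _ [_ [r ->] <-]; rewrite setTI.
have -> : (support_fun K \o row_of) @^-1` `]r, +oo[ =
    row_of @^-1` (\bigcup_(y in K) (dot^~ y @^-1` `]r, +oo[)).
  apply/seteqP; split=> t /=; have [y [Ky -> ymax]] := Kmax (row_of t).
    by rewrite in_itv/= andbT => ry; exists y => //=; rewrite in_itv/= ry.
  move=> [z Kz]; rewrite /= !in_itv/= !andbT => /lt_le_trans; apply.
  exact: ymax.
apply: measurable_row_of_open; apply: bigcup_open => y _.
rewrite (_ : dot^~ y = dot y); last by apply/funext => x; exact: dotC.
apply: open_comp => [x _|]; first exact: dot_continuous.
exact: interval_open.
Qed.

End SupportMeasurable.

(** * Gaussian vectors and isometries *)

Section GaussianVector.
Context {R : realType} {disp : measure_display} {T : measurableType disp}.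
Context (P : probability T R) {n : nat} (Z : 'I_n -> {RV P >-> R}).

(** The tuple form of [random_row]: tuples carry the product sigma-algebra on which laws are
    compared. *)
Definition tuple_of_family (w : T) : n.-tuple R := [tuple Z i w | i < n].

Lemma random_rowE w : random_row Z w = row_of (tuple_of_family w).
Proof. by apply/rowP => i; rewrite !mxE tnth_mktuple. Qed.

Lemma measurable_tuple_of_family : measurable_fun setT tuple_of_family.
Proof.
apply/measurable_fun_tnthP => i; rewrite /comp/=.
under eq_fun do rewrite tnth_mktuple.
exact: measurable_funP.
Qed.

(** A box is the intersection of conditions on all coordinates, so independence is used for the full
    index set. *)
Lemma gaussian_law_vector : standard_gaussian_vector Z ->
  gaussian_law (pushforward P tuple_of_family).
Proof.
move=> [indZ stdZ] A mA; have := indZ [set: 'I_n]%SET A mA.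
rewrite [X in P X](_ : _ = tuple_of_family @^-1` box A); last first.
  apply/seteqP; split=> w Zw i /=; last by move=> _; have := Zw i; rewrite tnth_mktuple.
  by rewrite tnth_mktuple; apply: Zw; rewrite /= inE.
rewrite /pushforward => ->; rewrite big_mkcond/=.
by apply: eq_bigr => i _; rewrite inE; exact: (stdZ i _ (mA i)).
Qed.

End GaussianVector.

(** * Projection and isometry in coordinates *)

Section Isometry.
Context {R : realType} {d m : nat} {S : {vspace 'rV[R]_d}}.
Context (proj : 'rV[R]_d -> subvs_of S) (iota : {linear subvs_of S -> 'rV[R]_m}).
Hypotheses (hproj : orthogonal_projection proj)
  (hiota : euclidean_isometry iota) (hS : \dim S = m).
Implicit Types (x y : 'rV[R]_d) (u v : subvs_of S).

Lemma dotBl n (x y z : 'rV[R]_n) : dot (x - y) z = dot x z - dot y z.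
Proof. by rewrite /dot -sumrB; apply: eq_bigr => i _; rewrite !mxE mulrBl. Qed.

Lemma dot_polarization n (x y : 'rV[R]_n) :
  dot (x - y) (x - y) = dot x x + dot y y - 2 * dot x y.
Proof.
rewrite /dot mulr_sumr -big_split -sumrB/=; apply: eq_bigr => i _.
by rewrite !mxE; ring.
Qed.

Lemma dot_ge0 n (x : 'rV[R]_n) : 0 <= dot x x.
Proof. by apply: sumr_ge0 => i _; rewrite -expr2 sqr_ge0. Qed.

Lemma dot_eq0 n (x : 'rV[R]_n) : dot x x = 0 -> x = 0.
Proof.
move=> /eqP; rewrite psumr_eq0 => [/allP x0|i _]; last by rewrite -expr2 sqr_ge0.
apply/rowP => i; rewrite mxE; apply/eqP.
by rewrite -sqrf_eq0 expr2; exact: (x0 i (mem_index_enum i)).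
Qed.

Lemma dot_proj x y : y \in S -> dot (vsval (proj x)) y = dot x y.
Proof. by move=> yS; apply/esym/eqP; rewrite -subr_eq0 -dotBl hproj. Qed.

Lemma proj_id y : y \in S -> vsval (proj y) = y.
Proof.
move=> yS; apply/esym/eqP; rewrite -subr_eq0; apply/eqP/dot_eq0.
by rewrite hproj// rpredB// subvsP.
Qed.

(** Distances to the image of 0 give the norms, and polarization then gives the inner products. *)
Lemma dot_isometry u v : dot (iota u) (iota v) = dot (vsval u) (vsval v).
Proof.
have sq u' v' : dot (iota u' - iota v') (iota u' - iota v') =
    dot (vsval u' - vsval v') (vsval u' - vsval v').
  by have /(congr1 (fun r : R => r ^+ 2)) := hiota u' v'; rewrite !sqr_sqrtr ?dot_ge0.
have nrm u' : dot (iota u') (iota u') = dot (vsval u') (vsval u').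
  by have := sq u' 0; rewrite !raddf0 !addr0.
have := sq u v; rewrite !dot_polarization !nrm => /addrI/oppr_inj.
by apply: mulfI; rewrite pnatr_eq0.
Qed.

(** Preserving inner products makes [iota] injective, and [S] has the dimension [m] of the
    target. *)
Lemma isometry_onto (y : 'rV[R]_m) : exists u, iota u = y.
Proof.
have ker0 : lker (linfun iota) == 0%VS.
  apply/lker0P => u v; rewrite !lfunE /= => uv.
  have uv0 : iota (u - v) = 0 by rewrite linearB /= uv subrr.
  apply/eqP; rewrite -subr_eq0; apply/eqP/val_inj/dot_eq0.
  by rewrite -dot_isometry uv0; apply: big1 => i _; rewrite mxE mul0r.
have : y \in limg (linfun iota).
  rewrite (_ : limg _ = fullv) ?memvf//; apply/eqP.
  rewrite eqEdim subvf limg_dim_eq; last by rewrite (eqP ker0) capv0.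
  by rewrite !dimvf dim_matrix mul1r -hS leqnn.
by case/memv_imgP => u _ ->; exists u; rewrite lfunE.
Qed.

(** The vector [a l] is the preimage of the [l]-th standard basis vector; pairing [x] with it agrees
    with pairing [iota (proj x)] with that basis vector. *)
Lemma isometry_coords : exists a : 'I_m -> 'rV[R]_d,
  orthonormal_family a /\ forall x, row_of (coords a x) = iota (proj x).
Proof.
have [u iu] := choice (fun l : 'I_m => isometry_onto (delta_mx 0 l)).
have dot_delta (x : 'rV[R]_m) l : dot x (delta_mx 0 l) = x 0 l.
  rewrite /dot (bigD1 l)//= big1 => [|k /negPf kl]; rewrite mxE ?eqxx/=.
    by rewrite mulr1 addr0.
  by rewrite kl mulr0.
exists (fun l => vsval (u l)); split=> [l l'|x].
  by rewrite -dot_isometry !iu dot_delta mxE eqxx eq_sym.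
apply/rowP => l; rewrite mxE tnth_mktuple -dot_proj ?subvsP//.
by rewrite -dot_isometry iu dot_delta.
Qed.

Lemma support_fun_isometry (K : set 'rV[R]_d) x : (forall y, K y -> y \in S) ->
  support_fun ((iota \o proj) @` K) (iota (proj x)) = support_fun K x.
Proof.
move=> KS; rewrite /support_fun image_comp; congr sup.
apply: eq_imagel => y Ky /=.
by rewrite dot_isometry (proj_id (KS _ Ky)) dot_proj ?KS.
Qed.

(** Every [x] is some [iota u], and the image of a maximiser for [u] is a maximiser for [x]. *)
Lemma support_fun_isometry_max (K : set 'rV[R]_d) :
  convex_body K -> (forall y, K y -> y \in S) ->
  forall x : 'rV[R]_m, exists y : 'rV[R]_m, [/\ ((iota \o proj) @` K) y,
    support_fun ((iota \o proj) @` K) x = dot x y &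
    forall z, ((iota \o proj) @` K) z -> dot x z <= dot x y].
Proof.
move=> bK KS x; have [u <-] := isometry_onto x.
have uE : iota u = iota (proj (vsval u)).
  by congr (iota _); apply: val_inj; rewrite /= proj_id// subvsP.
have dotE y : K y -> dot (iota u) (iota (proj y)) = dot (vsval u) y.
  by move=> Ky; rewrite dot_isometry (proj_id (KS _ Ky)).
have [y [Ky yE ymax]] := support_fun_max (vsval u) bK.
exists (iota (proj y)); split; first by exists y.
  by rewrite dotE// -yE uE support_fun_isometry.
by move=> _ [z Kz <-]; rewrite /= !dotE// ymax.
Qed.

End Isometry.

(** * Comparison of the two expectations *)

Lemma expectation_tuple_of_family (R : realType) (disp : measure_display)
    (T : measurableType disp) (P : probability T R) (n : nat)
    (Z : 'I_n -> {RV P >-> R}) (g : n.-tuple R -> R) :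
  measurable_fun setT g -> (forall t, 0 <= g t) ->
  ('E_P[g \o tuple_of_family Z] =
   \int[pushforward P (tuple_of_family Z)]_t (g t)%:E)%E.
Proof.
move=> mg g0; have mZ := measurable_tuple_of_family Z.
rewrite expectation.unlock.
rewrite [RHS](@ge0_integral_pushforward _ _ _ _ _ _ mZ P setT (EFin \o g))//.
  exact/measurable_EFinP.
by move=> t _; rewrite lee_fin.
Qed.

Unset Implicit Arguments.

Theorem theorem1 (R : realType) (p : R) (hp : 1 <= p)
    (d m : nat) (hm : (1 <= m)%N) (hmd : (m < d)%N)
    (K L : set 'rV[R]_d) (hK : convex_body K) (hL : convex_body L)
    (S : {vspace 'rV[R]_d}) (hS : \dim S = m)
    (hKS : forall x, K x -> x \in S) (hLS : forall x, L x -> x \in S)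
    (proj : 'rV[R]_d -> subvs_of S) (hproj : orthogonal_projection proj)
    (iota : {linear subvs_of S -> 'rV[R]_m}) (hiota : euclidean_isometry iota)
    (dispd : measure_display) (Td : measurableType dispd)
    (Pd : probability Td R) (Zd : 'I_d -> {RV Pd >-> R})
    (hZd : standard_gaussian_vector Zd)
    (dispm : measure_display) (Tm : measurableType dispm)
    (Pm : probability Tm R) (Zm : 'I_m -> {RV Pm >-> R})
    (hZm : standard_gaussian_vector Zm) :
  intrinsic_Lp_metric Zd p K L =
  intrinsic_Lp_metric Zm p ((iota \o proj) @` K) ((iota \o proj) @` L).
Proof.
have [a [oa aE]] := isometry_coords hproj hiota hS.
set sK := _ @` K; set sL := _ @` L.
pose g (t : m.-tuple R) :=
  `|support_fun sK (row_of t) - support_fun sL (row_of t)| `^ p.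
have mg : measurable_fun setT g.
  apply: (@measurableT_comp _ _ _ _ _ _ (@powR R ^~ p)).
    exact: measurable_powR.
  apply: (@measurableT_comp _ _ _ _ _ _ (@Num.norm R R)) => //.
  by apply: measurable_funB; apply: measurable_support_fun;
    exact: (support_fun_isometry_max hproj hiota hS).
have gE w : `|support_fun K (random_row Zd w) -
    support_fun L (random_row Zd w)| `^ p =
    (g \o (coords a \o row_of)) (tuple_of_family Zd w).
  rewrite /g/= aE -random_rowE.
  by rewrite !(support_fun_isometry hproj hiota).
(* The constant and the exponent depend on [p] alone, so only the expectations are left. *)
rewrite /intrinsic_Lp_metric; congr ((_ * _) `^ _)%E.
have mZm := measurable_tuple_of_family Zm.
have mZd := measurable_tuple_of_family Zd.
have mc := measurable_coords a.
rewrite (_ : (fun w => _) = (g \o (coords a \o row_of)) \o tuple_of_family Zd);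
  last exact/funext.
rewrite [in RHS](_ : (fun w => _) = g \o tuple_of_family Zm); last first.
  by apply/funext => w; rewrite /g/= -random_rowE.
have g0 t : 0 <= g t by exact: powR_ge0.
rewrite !expectation_tuple_of_family//; last 2 first.
- exact: (measurableT_comp mg mc).
- by move=> t; exact: g0.
have law_d := gaussian_law_vector hZd.
have law_m := gaussian_law_vector hZm.
pose nu : {measure set (d.-tuple R) -> \bar R} :=
  pushforward Pd (tuple_of_family Zd).
have law_c := gaussian_law_coords hmd oa (law_d : gaussian_law (nu mZd)).
(* After this change of variables both sides integrate [g], against two measures on [m]-tuples that
   are both Gaussian. *)
rewrite -[LHS](@ge0_integral_pushforward _ _ _ _ _ _ mc (nu mZd) setT
  (EFin \o g))//; last 2 first.
- exact/measurable_EFinP.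
- by move=> t _; rewrite lee_fin.
by apply: eq_measure_integral => A mA _; exact: (gaussian_law_unique law_c law_m).
Qed.
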